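(* Let $\kappa$ be an infinite cardinal, and let $\mathcal{L}\subsetneq\mathrm{Lin}_\kappa$ be nonempty and downward $\preceq$-closed and such that $\trianglelefteq^{\mathcal{L}}_\kappa$ is transitive. Then there is a family $\mathcal{F}\subseteq\mathrm{LO}_\kappa$ of size $\kappa^+$ which is unbounded with respect to $\trianglelefteq^{\mathcal{L}}_\kappa$. Thus $\mathfrak{b}(\trianglelefteq^{\mathcal{L}}_\kappa)=\kappa^+$.
   Context: Linear orders are reflexive and nonempty; $L\preceq L'$ means there is an embedding $f:L\to L'$, i.e. $x\le_L y\iff f(x)\le_{L'}f(y)$. For a cardinal $\kappa$, $\mathrm{LO}_\kappa$ is the set of (codes for) linear orders with domain $\kappa$, and $\mathrm{Lin}_\kappa=\bigcup_{0<\lambda\le\kappa}\mathrm{LO}_\lambda$ ($\lambda$ ranging over cardinals), i.e. the nonempty linear orders of size at most $\kappa$. $\mathcal{L}\subseteq\mathrm{Lin}_\kappa$ is downward $\preceq$-closed if $K\in\mathrm{Lin}_\kappa$, $K\preceq L\in\mathcal{L}$ imply $K\in\mathcal{L}$; membership is meant up to isomorphism. A subset $I$ of $L$ is convex if $x\le_L y\le_L z$ and $x,z\in I$ imply $y\in I$. A $K$-convex partition of $L$ is a partition $(L_k)_{k\in K}$ of $L$ (into nonempty sets) such that $k<_K k'\iff$ every element of $L_k$ is $<_L$ every element of $L_{k'}$. $L\trianglelefteq^{\mathcal{L}}L'$ iff there are $K\in\mathcal{L}$, a $K$-convex partition $(L_k)_{k\in K}$ of $L$, and an embedding $f$ of $L$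 into $L'$ such that each $f(L_k)$ is a convex subset of $L'$. $\trianglelefteq^{\mathcal{L}}_\kappa$ is the restriction of $\trianglelefteq^{\mathcal{L}}$ to $\mathrm{LO}_\kappa$. For a quasi-order $\precsim$ on $X$, $\mathcal{F}\subseteq X$ is unbounded if there is no $x\in X$ with $y\precsim x$ for all $y\in\mathcal{F}$; the unbounding number $\mathfrak{b}(\precsim)$ is the least size of an unbounded subset of $X$. *)

(* Defs.v *)
From Stdlib Require Import RelationClasses.
From mathcomp Require Import all_boot.
From mathcomp Require Import boolp classical_sets functions cardinality wochoice.

Set Implicit Arguments.
Unset Strict Implicit.
Unset Printing Implicit Defensive.

Local Open Scope classical_set_scope.
Local Open Scope card_scope.

(* Cardinals are represented by types, or by subsets of types, compared with
   #<= and #=. *)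

Definition card_lt T U (A : set T) (B : set U) : Prop := A #<= B /\ ~ (B #<= A).

(* |B| = |A|^+ *)
Definition is_card_succ T U (A : set T) (B : set U) : Prop :=
  card_lt A B /\ forall V (C : set V), card_lt A C -> B #<= C.

(* The carrier may be empty here; nonemptiness is part of [Lin], and holds in
   [LO kappa] as soon as kappa is nonempty. *)
Record linorder := Linorder {
  carrier :> Type;
  le : rel carrier;
  le_total_order : total_order le }.

(* Codes for the linear orders with domain kappa. *)
Record LO (kappa : Type) := LOrder {
  LO_le :> rel kappa;
  LO_total_order : total_order LO_le }.

Definition linorder_of_LO kappa (L : LO kappa) : linorder :=
  Linorder (LO_total_order L).
Coercion linorder_of_LO : LO >-> linorder.

Definition lt (L : linorder) (x y : L) : Prop := le x y /\ x <> y.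

Definition embedding (L L' : linorder) (f : L -> L') : Prop :=
  forall x y, le x y = le (f x) (f y).

Definition embeds (L L' : linorder) : Prop :=
  exists f : L -> L', embedding f.

(* Every linear order of size at most kappa is a member, not only those whose
   domain is a cardinal. *)
Definition Lin (kappa : Type) : set linorder :=
  [set L | [set: L] !=set0 /\ [set: L] #<= [set: kappa]].

(* Since isomorphic orders embed into each other, such classes are closed under
   isomorphism. *)
Definition downward_closed (kappa : Type) (calL : set linorder) : Prop :=
  forall K L : linorder, Lin kappa K -> embeds K L -> calL L -> calL K.

Definition convex (L : linorder) (I : set L) : Prop :=
  forall x y z, le x y -> le y z -> I x -> I z -> I y.

Definition convex_partition (K L : linorder) (P : K -> set L) : Prop :=
  partition [set: K] P [set: L] /\
  forall k k', lt k k' <-> (forall x y, P k x -> P k' y -> lt x y).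

Definition convex_emb (calL : set linorder) (L L' : linorder) : Prop :=
  exists (K : linorder) (P : K -> set L) (f : L -> L'),
    [/\ calL K, convex_partition P, embedding f
      & forall k, convex (f @` P k)].

Definition convex_emb_LO (kappa : Type) (calL : set linorder)
    (L L' : LO kappa) : Prop :=
  convex_emb calL L L'.

Definition unbounded X (R : X -> X -> Prop) (F : set X) : Prop :=
  ~ exists x, forall y, F y -> R y x.

(* b(R) = |B| *)
Definition is_unbounding_number X U (R : X -> X -> Prop) (B : set U) : Prop :=
  (exists F, unbounded R F /\ F #= B) /\
  forall F, unbounded R F -> B #<= F.

(* Main.v *)
Require Import Defs.
From Stdlib Require Import RelationClasses.
From Stdlib Require Import Inverse_Image.
From mathcomp Require Import all_boot.
From mathcomp Require Import boolp classical_sets functions cardinality wochoice.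

Set Implicit Arguments.
Unset Strict Implicit.
Unset Printing Implicit Defensive.

Local Open Scope classical_set_scope.
Local Open Scope card_scope.

(** Why the theorem holds.  Call a family of orders on kappa bounded when some
    order on kappa lies above all its members.

    A family of at most kappa orders on kappa is bounded by their lexicographic
    sum, which has size kappa * kappa = kappa and in which every summand is
    convex, so that the one-piece partition suffices
    ([small_family_bounded]).  Hence every unbounded family has more than kappa
    members ([unbounded_card_gt]).

    For an unbounded family of size kappa^+, choose M of size kappa outside calL
    and realize kappa^+ as a subset D of a well-order X all of whose segments
    [{e | e <= d}], for d in D, have size at most kappa
    ([well_ordered_card_succ]).  The family consists of the products
    M x [{e | e <= d}], every point of M being replaced by a copy of the
    segment.  Suppose that they all lie below some order B on kappa.
    - If each copy of the segment were cut by the partition into pieces, then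
      sending a point of M to the piece of the least element of its copy would
      be strictly increasing; M would embed in the index order of the partition
      and belong to calL.  So some copy lies inside one piece, and
      [{e | e <= d}] has a convex embedding h_d in B ([convex_emb_lexprod]).
    - The ends h_d(min) and h_d(d) of the image determine d: two segments
      d < d' with the same image interval would give a strictly increasing map
      of the longer well-order into a proper initial segment
      ([segment_emb_inj]).
    So D injects into kappa x kappa, which has size kappa: a contradiction.

    The cardinal arithmetic behind this is comparability of cardinals
    ([card_le_total]) and A x A <= A for infinite A ([infinite_card_setX]); both
    follow from one transfinite recursion ([transfinite_card_le]). *)

(** * Linear orders *)

Section LinearOrders.
Variable L : linorder.
Implicit Types x y z : L.

Lemma le_refl x : le x x.
Proof. by case: (le_total_order L) => -[[]]. Qed.

Lemma le_trans y x z : le x y -> le y z -> le x z.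
Proof. by case: (le_total_order L) => -[[_ +]] _ _; apply. Qed.

Lemma le_anti x y : le x y -> le y x -> x = y.
Proof. by case: (le_total_order L) => -[_ anti] _ xy yx; apply/anti/andP. Qed.

Lemma le_or_lt x y : le x y \/ lt y x.
Proof.
have [->|xy] := pselect (y = x); first by left; exact: le_refl.
by case: (le_total_order L) => _ /(_ x y)/orP[]; [left|right].
Qed.

Lemma lt_or_eq x y : [\/ lt x y, x = y | lt y x].
Proof.
have [->|xy] := pselect (x = y); first exact: Or32.
have [|] := le_or_lt x y; [|exact: Or33].
by move=> lexy; apply: Or31.
Qed.

Lemma lt_leN x y : lt x y -> ~ le y x.
Proof. by move=> [lexy xy] leyx; apply/xy/le_anti. Qed.

Lemma lt_le_trans y x z : lt x y -> le y z -> lt x z.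
Proof.
move=> [lexy xy] leyz; split; first exact: le_trans leyz.
by move=> xz; apply: xy; apply: le_anti; rewrite // xz.
Qed.

Lemma le_lt_trans y x z : le x y -> lt y z -> lt x z.
Proof.
move=> lexy [leyz yz]; split; first exact: le_trans leyz.
by move=> xz; apply: yz; apply: le_anti; rewrite // -xz.
Qed.

End LinearOrders.

Lemma strict_mono_embedding (L L' : linorder) (f : L -> L') :
  (forall x y, lt x y -> lt (f x) (f y)) -> embedding f.
Proof.
move=> fmono x y; apply/idP/idP => [xy|fxy].
  by case: (lt_or_eq x y) => [/fmono[]//|->|/lt_leN//]; exact: le_refl.
by case: (le_or_lt x y) => // /fmono/lt_leN.
Qed.

Lemma embedding_inj (L L' : linorder) (f : L -> L') :
  embedding f -> injective f.
Proof.
by move=> fE x y fxy; apply: le_anti; rewrite fE fxy; exact: le_refl.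
Qed.

Lemma embedding_lt (L L' : linorder) (f : L -> L') x y :
  embedding f -> lt x y -> lt (f x) (f y).
Proof.
move=> fE [xy nxy]; split; first by rewrite -fE.
by move/(embedding_inj fE).
Qed.

(** Every nonempty subset has a least element; uniqueness is automatic since [L]
    is a linear order. *)
Definition well_ordered (L : linorder) : Prop :=
  forall A : set L, A !=set0 -> exists2 x, A x & forall y, A y -> le x y.

Lemma well_ordered_wf (L : linorder) : well_ordered L -> well_founded (@lt L).
Proof.
move=> woL x; apply: contrapT => nx.
have [y ny ymin] := woL [set z | ~ Acc (@lt L) z] (ex_intro _ x nx).
apply: ny; constructor => z zy; apply: contrapT => /ymin.
exact: lt_leN.
Qed.

Lemma well_order_total T (R : rel T) : wochoice.well_order R -> total_order R.
Proof.
move=> woR.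
have Rmin (A : set T) : A !=set0 -> exists2 x, A x & forall y, A y -> R x y.
  move=> [a Aa]; have [|x [[/set_mem Ax xmin] _]] := woR (mem A).
    by exists a; exact: mem_set.
  by exists x => // y Ay; apply: xmin; exact: mem_set.
have Rtot : total R.
  move=> x y; have [|z] := Rmin [set x; y]; first by exists x; left.
  by move=> -[->|->] zmin; apply/orP; [left|right]; apply: zmin; [right|left].
have Rrefl : reflexive R by move=> x; have := Rtot x x; rewrite orbb.
have Ranti : antisymmetric R.
  move=> x y /andP[xy yx].
  have [|z [_ zuniq]] := woR (mem [set x; y]).
    by exists x; apply/mem_set; left.
  rewrite -(zuniq x) ?(zuniq y)//; split => [|w /set_mem[]->//]; apply/mem_set.
    by right.
  by left.
have Rtrans : transitive R.
  move=> y x z xy yz.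
  have [|w] := Rmin [set w | w = x \/ w = y \/ w = z].
    by exists x; left.
  case=> [->|[->|->]] wmin; first by apply: wmin; right; right.
    have -> : x = y by apply: Ranti; rewrite xy wmin//; left.
    exact: yz.
  have <- : y = z by apply: Ranti; rewrite yz wmin//; right; left.
  exact: xy.
by split; [split|].
Qed.

Lemma well_order_exists T :
  exists R : rel T, exists Rto : total_order R, well_ordered (Linorder Rto).
Proof.
have [R woR] := well_ordering_principle {classic T}.
exists R, (well_order_total woR) => A [a Aa].
have [|x [[/set_mem Ax xmin] _]] := woR (mem A).
  by exists a; exact: mem_set.
by exists x => // y Ay; apply: xmin; exact: mem_set.
Qed.

(** The sum over [I] of the orders [R i], all living on the same type [T]: pairs
    are compared by their first coordinates and then, within the fibre over
    [i], by [R i]. *)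
Section LexicographicSum.
Variables (I : linorder) (T : Type) (R : I -> rel T).
Hypothesis Rto : forall i, total_order (R i).

Definition lexsum_le : rel (I * T) := fun p q =>
  `[< lt p.1 q.1 \/ p.1 = q.1 /\ R p.1 p.2 q.2 >].

Lemma lexsum_le_total_order : total_order lexsum_le.
Proof.
pose F i := Linorder (Rto i).
split; [split; [split|]|].
- by move=> p; apply/asboolP; right; split=> //; exact: (@le_refl (F p.1)).
- move=> [j y] [i x] [k z] /asboolP[/= ij|/= [<- xy]] /asboolP[/= jk|/= [<- yz]].
  + by apply/asboolP; left; case: jk => + _; exact: lt_le_trans.
  + by apply/asboolP; left.
  + by apply/asboolP; left.
  + by apply/asboolP; right; split=> //; exact: (@le_trans (F i) y).
- move=> [i x] [j y] /andP[] /asboolP[/= ij|/= [-> xy]] /asboolP[/= ji|/= [e yx]].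
  + by case: ij => /(lt_leN ji).
  + by move: ij; rewrite e => -[].
  + by case: ji.
  + by congr pair; exact: (@le_anti (F j)).
- move=> [i x] [j y]; apply/orP; case: (lt_or_eq i j) => [ij|<-|ji].
  + by left; apply/asboolP; left.
  + case: (@le_total_order (F i)) => _ /(_ x y)/orP[xy|yx].
    * by left; apply/asboolP; right.
    * by right; apply/asboolP; right.
  + by right; apply/asboolP; left.
Qed.

Definition lexsum : linorder := Linorder lexsum_le_total_order.

Lemma lexsum_leP (p q : lexsum) :
  le p q <-> lt p.1 q.1 \/ p.1 = q.1 /\ R p.1 p.2 q.2.
Proof. by split=> [/asboolP|h]//; apply/asboolP. Qed.

End LexicographicSum.

(** The sum of [I] copies of [L]. *)
Definition lexprod (I L : linorder) : linorder :=
  @lexsum I L (fun=> @le L) (fun=> le_total_order L).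

Lemma lexprod_well_ordered (I L : linorder) :
  well_ordered I -> well_ordered L -> well_ordered (lexprod I L).
Proof.
move=> woI woL A [[i0 x0] A0].
have [|i [x Aix] imin] := woI [set i | exists x, A (i, x)]; first by exists i0, x0.
have [|y Aiy ymin] := woL [set y | A (i, y)]; first by exists x.
exists (i, y) => // -[j z] Ajz; apply/lexsum_leP => /=.
case: (lt_or_eq i j) => [|ij|/lt_leN]; [by left| |by case; apply: imin; exists z].
by right; split=> //; apply: ymin; rewrite /= ij.
Qed.

Definition suborder_le (L : linorder) (A : set L) : rel {x : L | x \in A} :=
  fun x y => le (val x) (val y).

Lemma suborder_le_total_order (L : linorder) (A : set L) :
  total_order (@suborder_le L A).
Proof.
split; [split; [split|]|].
- by move=> x; exact: le_refl.
- by move=> y x z; exact: le_trans.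
- by move=> x y /andP[xy yx]; apply: val_inj; exact: le_anti.
- by move=> x y; case: (le_total_order L) => _; exact.
Qed.

(** The order induced on a subset. *)
Definition suborder (L : linorder) (A : set L) : linorder :=
  Linorder (@suborder_le_total_order L A).

(** * Cardinal arithmetic *)

Lemma inj_on_card_le T U (A : set T) (B : set U) (f : T -> U) :
  set_fun A B f -> set_inj A f -> A #<= B.
Proof.
move=> fAB finj; have /injfunPex[g] : exists2 f, set_fun A B f & set_inj A f.
  by exists f.
exact: inj_card_le.
Qed.

Lemma card_le_inj_on T U (A : set T) (B : set U) : A !=set0 -> A #<= B ->
  exists2 f : T -> U, set_fun A B f & set_inj A f.
Proof.
move=> [a Aa] /card_leP[f]; apply/injfunPex.
by squash (valLR (val (f (SigSub (mem_set Aa)))) f).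
Qed.

Lemma card_le_setX T T' U U' (A : set T) (B : set U) (A' : set T') (B' : set U') :
  A #<= B -> A' #<= B' -> A `*` A' #<= B `*` B'.
Proof.
have [->|/set0P A0] := eqVneq A set0; first by rewrite set0X.
have [->|/set0P A'0] := eqVneq A' set0; first by rewrite setX0.
move=> /(card_le_inj_on A0)[f fAB finj] /(card_le_inj_on A'0)[g gAB ginj].
apply: (@inj_on_card_le _ _ _ _ (fun p => (f p.1, g p.2))).
  by move=> [x y] [/= Ax Ay]; split; [apply: fAB|apply: gAB].
move=> [x y] [x' y'] /set_mem[/= Ax Ay] /set_mem[/= Ax' Ay'] [fxx' gyy'].
by congr pair; [apply: finj|apply: ginj] => //; exact: mem_set.
Qed.

(** If no initial segment of [A] is as large as [B], then recursion along [R]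
    never runs out of fresh values in [B], and so injects [A] into [B]. *)
Lemma transfinite_card_le T U (R : T -> T -> Prop) (A : set T) (B : set U) :
  well_founded R -> (forall x y, [\/ R x y, x = y | R y x]) ->
  (forall x, A x -> ~ (B #<= A `&` [set y | R y x])) -> A #<= B.
Proof.
move=> Rwf Rtri AB.
have [->|/set0P[a Aa]] := eqVneq A set0; first exact: card_ge0.
have [u0 _] : B !=set0.
  by apply/set0P/eqP => B0; apply: (AB a Aa); rewrite B0; exact: card_ge0.
(* [avoid x rec] is the set of values still available at [x] when [rec] gives
   the values already chosen below [x]. *)
pose avoid x (rec : forall y, R y x -> U) : set U :=
  [set u | B u /\ forall y (h : R y x), A y -> rec y h <> u].
pose step x (rec : forall y, R y x -> U) : U :=
    if pselect (exists u, avoid x rec u) is left e then sval (cid e) else u0.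
pose f := Fix Rwf (fun=> U) step.
have fE x : f x = step x (fun y _ => f y).
  apply: (Fix_eq Rwf (fun=> U) step) => {}x g h gh; congr step.
  by apply: functional_extensionality_dep => y; apply: funext => ?; exact: gh.
have fP x : A x -> B (f x) /\ forall y, R y x -> A y -> f y <> f x.
  move=> Ax; suff : avoid x (fun y _ => f y) (f x) by [].
  rewrite [in X in avoid _ _ X]fE /step; case: pselect => [e|nex].
    exact: svalP (cid e).
  case: (AB x Ax); apply: (@card_le_trans _ _ _ (f @` (A `&` [set y | R y x]))).
    apply: subset_card_le => u Bu; apply: contrapT => nu; apply: nex.
    by exists u; split=> // y Ryx Ay fyu; apply: nu; exists y.
  exact: card_image_le.
apply: (@inj_on_card_le _ _ _ _ f) => [x /fP[]//|x y /set_mem Ax /set_mem Ay].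
case: (Rtri x y) => // [xy|yx] fxy.
  by case: (fP y Ay) => _ /(_ x xy Ax).
by case: (fP x Ax) => _ /(_ y yx Ay); rewrite fxy.
Qed.

Lemma card_le_total T U (A : set T) (B : set U) : A #<= B \/ B #<= A.
Proof.
have [R [Rto /well_ordered_wf wf]] := well_order_exists T.
have [BA|nBA] := pselect (B #<= A); [by right|left].
apply: (@transfinite_card_le _ _ (@lt (Linorder Rto))) => //.
  exact: lt_or_eq.
move=> x Ax /card_le_trans BA; apply/nBA/BA.
exact: subset_card_le.
Qed.

Lemma card_le_setU1 T (A : set T) (a : T) : infinite_set A -> a |` A #<= A.
Proof.
move=> /infiniteP natA.
have [s sA sinjT] := card_le_inj_on (ex_intro _ 0 I) natA.
have sinj : injective s by move=> m n; apply: sinjT; exact: in_setT.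
have [Aa|nAa] := pselect (A a).
  by apply: subset_card_le => x [->|].
(* Hilbert's hotel: shift the sequence [s] by one and put [a] at its start. *)
pose f x := if pselect (x = a) then s 0
  else if pselect (exists n, x = s n) is left e then s (sval (cid e)).+1 else x.
apply: (@inj_on_card_le _ _ _ _ f).
  move=> x xA; rewrite /f; case: (pselect (x = a)) => [?|xa]; first exact: sA.
  by case: pselect => [e|?]; [exact: sA|case: xA].
move=> x y _ _; rewrite /f.
case: (pselect (x = a)) => [xa|xa]; case: (pselect (y = a)) => [ya|ya] /=.
- by rewrite xa ya.
- by case: pselect => [e /sinj//|ny ye]; case: ny; exists 0.
- by case: pselect => [e /sinj//|nx xe]; case: nx; exists 0.
- case: pselect => [ex|nx]; case: pselect => [ey|ny] //.
  + by case: cid => n xn; case: cid => m ym /= /sinj[nm]; rewrite xn ym nm.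
  + by move=> e; case: ny; exists (sval (cid ex)).+1.
  + by move=> e; case: nx; exists (sval (cid ey)).+1.
Qed.

Lemma finite_card_le T U (A : set T) (B : set U) :
  finite_set A -> infinite_set B -> A #<= B.
Proof.
move=> Afin Binf; have [//|BA] := card_le_total A B.
by case: Binf; exact: card_le_finite BA Afin.
Qed.

(** Goedel's ordering of pairs: compare the maxima of the coordinates first, and
    then the pairs lexicographically.  The pairs below [p] lie in the square of
    the closed segment bounded by the maximum of [p]. *)
Section Squares.
Variable X : linorder.
Hypothesis woX : well_ordered X.

Let max2 (p : X * X) : X := if le p.1 p.2 then p.2 else p.1.
Let key (p : X * X) : lexprod X (lexprod X X) := (max2 p, p).

Let max2_ge1 p : le p.1 (max2 p).
Proof. by rewrite /max2; case: ifP => // _; exact: le_refl. Qed.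

Let max2_ge2 p : le p.2 (max2 p).
Proof.
rewrite /max2; case: ifP => [_|]; first exact: le_refl.
by case: (le_or_lt p.1 p.2) => [->//|[]].
Qed.

(** The inductive step of A x A <= A: from all proper open segments of [S] to [S]
    itself.  Either [S] is no larger than one of its segments, or all its
    segments are smaller and Goedel's ordering of [S `*` S] has segments smaller
    than [S]. *)
Lemma initial_segment_card_setX (S : set X) :
  (forall x y, S x -> le y x -> S y) -> infinite_set S ->
  (forall x, S x -> infinite_set [set y | lt y x] ->
     [set y | lt y x] `*` [set y | lt y x] #<= [set y | lt y x]) ->
  S `*` S #<= S.
Proof.
move=> Sinit Sinf IH.
have [[x Sx SIx]|nS] := pselect (exists2 x, S x & S #<= [set y | lt y x]).
  have Iinf : infinite_set [set y | lt y x].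
    by move=> Ifin; apply: Sinf; exact: card_le_finite SIx Ifin.
  apply: card_le_trans (card_le_setX SIx SIx) _.
  apply: card_le_trans (IH x Sx Iinf) _.
  by apply: subset_card_le => y [yx _]; exact: Sinit yx.
apply: (@transfinite_card_le _ _ (fun p q => lt (key p) (key q))).
- apply: wf_inverse_image; apply: well_ordered_wf.
  by do ![apply: lexprod_well_ordered => //].
- move=> p q; case: (lt_or_eq (key p) (key q)) => [|[_]|];
    [exact: Or31|exact: Or32|exact: Or33].
move=> p [Sp1 Sp2] SJ; set m := max2 p.
have Sm : S m by rewrite /m /max2; case: ifP.
have {}SJ : S #<= (m |` [set y | lt y m]) `*` (m |` [set y | lt y m]).
  apply: card_le_trans SJ _; apply: subset_card_le => q [_ [/lexsum_leP qp _]].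
  have qm : le (max2 q) m.
    by case: qp => [[]//|[/= -> _]]; exact: le_refl.
  have in_seg y : le y (max2 q) -> (m |` [set y | lt y m]) y.
    move=> yq; have [->|ym] := pselect (y = m); [by left|right; split=> //].
    exact: le_trans qm.
  by split; apply: in_seg; [exact: max2_ge1|exact: max2_ge2].
have [Ifin|Iinf] := pselect (finite_set [set y | lt y m]).
  apply: Sinf; apply: card_le_finite SJ _.
  by apply: finite_setX; rewrite finite_setU; split=> //; exact: finite_set1.
apply: nS; exists m => //; apply: card_le_trans SJ _.
apply: card_le_trans (IH m Sm Iinf).
by apply: card_le_setX; exact: card_le_setU1.
Qed.

End Squares.

Lemma infinite_card_setX T (A : set T) : infinite_set A -> A `*` A #<= A.
Proof.
move=> Ainf.
(* The well-order is put on the subtype of [A], so that [A] becomes an initial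
   segment. *)
pose S := {x : T | x \in A}.
have AS : A #<= [set: S].
  apply: (@card_le_trans _ _ _ (val @` [set: S])); last exact: card_image_le.
  by apply: subset_card_le => x Ax; exists (exist _ x (mem_set Ax)).
have SA : [set: S] #<= A.
  apply: (@inj_on_card_le _ _ _ _ val) => [x _|x y _ _ /val_inj//].
  exact: set_mem (valP x).
apply: card_le_trans (card_le_setX AS AS) _; apply: card_le_trans SA.
have Sinf : infinite_set [set: S].
  by move=> Sfin; apply: Ainf; exact: card_le_finite AS Sfin.
have [R [Rto woS]] := well_order_exists S.
apply: (initial_segment_card_setX woS) => // x _.
elim/(well_founded_ind (well_ordered_wf woS)): x => x IH Iinf.
apply: (initial_segment_card_setX woS) => // y z yx zy.
exact: le_lt_trans yx.
Qed.

Lemma powerset_card_nle T : ~ ([set: T -> Prop] #<= [set: T]).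
Proof.
move=> /card_le_inj_on[|f _ finj]; first by exists (fun=> True).
pose A x := exists2 B : T -> Prop, f B = x & ~ B x.
have nA : ~ A (f A).
  move=> AfA; case: (AfA) => B fBA; apply.
  by have -> : B = A by apply: finj => //; exact: in_setT.
by apply: (nA); exists A.
Qed.

(** The successor of kappa, as the initial segment of a well-order on the power
    set of kappa that collects the points with at most kappa predecessors. *)
Lemma well_ordered_card_succ kappa : infinite_set [set: kappa] ->
  exists X : linorder, exists D : set X,
    [/\ well_ordered X, is_card_succ [set: kappa] D &
        forall d, D d -> [set e | le e d] #<= [set: kappa]].
Proof.
move=> kinf; have [R [Rto woX]] := well_order_exists (kappa -> Prop).
set X := Linorder Rto in woX.
pose D : set X := [set d | [set e | le e d] #<= [set: kappa]].
exists X, D; split=> //.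
have nDk : ~ (D #<= [set: kappa]).
  move=> Dk; have [DT|/existsNP[d nDd]] := pselect (forall d, D d).
    by apply: (@powerset_card_nle kappa); apply: card_le_trans Dk; exact: subset_card_le.
  have [d0 nD0 d0min] := woX (~` D) (ex_intro _ d nDd).
  apply: nD0; apply: (@card_le_trans _ _ _ (d0 |` D)).
    apply: subset_card_le => e /= ed0.
    have [->|ne] := pselect (e = d0); [by left|right; apply: contrapT => /d0min].
    exact: lt_leN.
  have [Dfin|Dinf] := pselect (finite_set D).
    by apply: finite_card_le => //; rewrite finite_setU; split.
  exact: card_le_trans (card_le_setU1 _ Dinf) Dk.
split=> [|V C [kC nCk]].
  by split=> //; case: (card_le_total [set: kappa] D).
(* It remains to see that a subset [C'] of [D] with more than kappa elements is as
   large as [D].  It is cofinal, so [D] is covered by the segments below the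
   points of [C'], each of size at most kappa. *)
have [//|CD] := card_le_total D C.
have C0 : C !=set0.
  by apply/set0P/eqP => C0; apply: nCk; rewrite C0; exact: card_ge0.
have [f fCD finj] := card_le_inj_on C0 CD.
pose C' := f @` C.
have CC' : C #<= C' by apply: (@inj_on_card_le _ _ _ _ f) => // x Cx; exists x.
have kC' : [set: kappa] #<= C' by exact: card_le_trans CC'.
have C'inf : infinite_set C'.
  by move=> C'fin; apply: kinf; exact: card_le_finite kC' C'fin.
apply: (@card_le_trans _ _ _ C'); last exact: card_image_le.
have cofinal d : exists c, D d -> C' c /\ le d c.
  have [Dd|nDd] := pselect (D d); last by exists d.
  apply: contrapT => nc; apply: nCk; apply: card_le_trans Dd.
  apply: (@inj_on_card_le _ _ _ _ f) => // x Cx /=.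
  case: (le_or_lt (f x) d) => // -[dx _]; case: nc.
  by exists (f x) => _; split=> //; exists x.
have small c : exists g : X -> kappa, D c -> set_inj [set e | le e c] g.
  have [k0 _] := infinite_setN0 kinf.
  have [Dc|nDc] := pselect (D c); last by exists (fun=> k0).
  have [|g _ ginj] := card_le_inj_on _ Dc; last by exists g.
  by exists c; exact: le_refl.
have [h hP] := choice cofinal; have [g gP] := choice small.
apply: (@card_le_trans _ _ _ (C' `*` [set: kappa])).
  apply: (@inj_on_card_le _ _ _ _ (fun d => (h d, g (h d) d))).
    by move=> d /hP[].
  move=> d e /set_mem/hP[[x /fCD Dx xh] dh] /set_mem/hP[_ eh] [he].
  have Dhd : D (h d) by rewrite -xh.
  by rewrite -he in eh *; apply: (gP _ Dhd); exact: mem_set.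
apply: card_le_trans (infinite_card_setX C'inf).
exact: card_le_setX.
Qed.

(** * Convex embeddings *)

Lemma convex_emb_iso calL (L L' L'' : linorder) (g : L -> L') :
  bijective g -> embedding g -> convex_emb calL L' L'' -> convex_emb calL L L''.
Proof.
move=> [g' gK g'K] gE [K [P [f [KL [[Pcov Ptriv Pn0] Plt] fE fconv]]]].
exists K, (fun k => g @^-1` P k), (f \o g); split=> //.
- split=> [|k k'].
    split.
    + by apply/seteqP; split=> // x _; have : [set: L'] (g x) by []; rewrite -Pcov.
    + by move=> k k' _ _ [x [Px Px']]; apply: Ptriv => //; exists (g x).
    + by move=> k _; have [y Py] := Pn0 k I; exists (g' y); rewrite /= g'K.
  split=> [/Plt h x y Px Py|h].
    have [gxy ngxy] := h _ _ Px Py; split; first by rewrite gE.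
    by move=> xy; apply: ngxy; rewrite xy.
  apply/Plt => x y Px Py; rewrite -(g'K x) -(g'K y); apply: embedding_lt => //.
  by apply: h; rewrite /= g'K.
- by move=> x y; rewrite gE fE.
- move=> k; suff -> : (f \o g) @` (g @^-1` P k) = f @` P k by exact: fconv.
  apply/seteqP; split=> _ [x Px <-]; first by exists (g x).
  by exists (g' x); rewrite /= g'K.
Qed.

Lemma convex_partition_convex (K L : linorder) (P : K -> set L) k :
  convex_partition P -> convex (P k).
Proof.
move=> [[Pcov _ _] Plt] x y z xy yz Px Pz.
have [k' _ Py] : cover [set: K] P y by rewrite Pcov.
case: (lt_or_eq k k') => [/Plt/(_ _ _ Pz Py)/lt_leN//|->//|].
by move=> /Plt/(_ _ _ Py Px)/lt_leN.
Qed.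

(** Since [I] is not in [calL], the pieces of an order indexed by [calL] cannot
    separate all the copies of [J]; one copy stays whole. *)
Lemma convex_emb_lexprod kappa calL (I J L' : linorder) (j0 : J) :
  downward_closed kappa calL -> Lin kappa I -> ~ calL I ->
  (forall j, le j0 j) -> convex_emb calL (lexprod I J) L' ->
  exists2 h : J -> L', embedding h & convex (range h).
Proof.
move=> down IL nI j0min [K [P [f [KL Ppart fE fconv]]]].
have [[Pcov _ _] Plt] := Ppart.
apply: contrapT => nh; apply: nI; apply: (down I K) => //.
have /choice[k kP] i : exists k, P k (i, j0).
  have : [set: lexprod I J] (i, j0) by [].
  by rewrite -Pcov => -[k _ Pk]; exists k.
exists k; apply: strict_mono_embedding => i i' ii'.
(* If [k i = k i'], the piece contains all that lies between [(i, j0)] and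
   [(i', j0)], hence the whole fibre over [i]. *)
case: (lt_or_eq (k i) (k i')) => // [kii'|/Plt/(_ _ _ (kP i') (kP i))]; last first.
  by move=> /lt_leN[]; apply/lexsum_leP; left.
case: nh; pose h j := f (i, j).
have fiberP j : P (k i) (i, j).
  apply: (@convex_partition_convex _ _ _ _ Ppart (i, j0) _ (i', j0)).
  - by apply/lexsum_leP; right; split=> //; exact: j0min.
  - by apply/lexsum_leP; left.
  - exact: kP.
  - by rewrite kii'; exact: kP.
exists h.
  move=> x y; rewrite /h -fE; apply/idP/idP => [xy|/lexsum_leP[[]//|[]//]].
  by apply/lexsum_leP; right.
move=> x y z xy yz [jx _ jxE] [jz _ jzE].
have [||[i1 j] _ fy] := fconv (k i) x y z xy yz.
- by exists (i, jx) => //; exact: fiberP.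
- by exists (i, jz) => //; exact: fiberP.
move: xy yz; rewrite -fy -jxE -jzE /h -!fE => /lexsum_leP xy /lexsum_leP yz.
have -> : i1 = i; last by exists j.
case: xy yz => [/= ii1|[/= -> _]//] [/= /lt_leN[]|[/= -> //]].
by case: ii1.
Qed.

(** Every order of size kappa has an isomorphic copy with domain kappa. *)
Lemma LO_iso kappa (L : linorder) : [set: L] #= [set: kappa] ->
  exists L' : LO kappa, exists2 f : L -> L', bijective f & embedding f.
Proof.
move=> /card_bijP[f [g fK gK]].
pose f' (x : L) : kappa := val (f (SigSub (in_setT x))).
pose g' (y : kappa) : L := val (g (SigSub (in_setT y))).
have f'K : cancel f' g'.
  move=> x; rewrite /g' /f'.
  set y := SigSub _; have -> : y = f (SigSub (in_setT x)) by exact: val_inj.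
  by rewrite fK.
have g'K : cancel g' f'.
  move=> x; rewrite /g' /f'.
  set y := SigSub _; have -> : y = g (SigSub (in_setT x)) by exact: val_inj.
  by rewrite gK.
pose R : rel kappa := fun x y => le (g' x) (g' y).
have Rto : total_order R.
  split; [split; [split|]|].
  - by move=> x; exact: le_refl.
  - by move=> y x z; exact: le_trans.
  - by move=> x y /andP[xy yx]; apply: (can_inj g'K); exact: le_anti.
  - by move=> x y; case: (le_total_order L) => _; exact.
exists (LOrder Rto), f'; first by exists g'.
by move=> x y; rewrite /= /R !f'K.
Qed.

(** The order with one element. *)
Definition point_order : linorder.
Proof.
by exists unit (fun _ _ => true); split; [split; [split|case=> [] []]|].
Defined.

Lemma point_order_in kappa (calL : set linorder) :
  calL !=set0 -> calL `<=` Lin kappa -> downward_closed kappa calL ->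
  calL point_order.
Proof.
move=> [L LL] calLin down; have [[x0 _] Lk] := calLin L LL.
apply: (down _ L) => //; last first.
  by exists (fun=> x0) => x y; rewrite le_refl.
split; first by exists tt.
apply: card_le_trans Lk; apply: (@inj_on_card_le _ _ _ _ (fun=> x0)) => //.
by move=> [] [].
Qed.

(** An embedding with convex range is piecewise convex for the partition into a
    single piece. *)
Lemma convex_range_emb (calL : set linorder) (L L' : linorder) (f : L -> L') :
  calL point_order -> [set: L] !=set0 -> embedding f -> convex (range f) ->
  convex_emb calL L L'.
Proof.
move=> calL1 L0 fE fconv; exists point_order, (fun=> setT), f; split=> //.
split=> [|[] []].
  split=> [|[] []//|//].
  by apply/seteqP; split=> // x _; exists tt.
split=> [[]//|h]; have [x _] := L0.
by case: (h x x I I).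
Qed.

(** * The unbounding number *)

Section Unbounding.
Variables (kappa : Type) (calL : set linorder).
Hypothesis kinf : infinite_set [set: kappa].

Lemma card_prod_infinite : [set: kappa * kappa] #= [set: kappa].
Proof.
rewrite -setXTT; apply/card_eqPle; split; first exact: infinite_card_setX.
have [k0 _] := infinite_setN0 kinf.
by apply: (@inj_on_card_le _ _ _ _ (fun x => (k0, x))) => // x y _ _ [].
Qed.

Lemma small_family_bounded (F : set (LO kappa)) : calL point_order ->
  F #<= [set: kappa] -> exists L, forall K, F K -> convex_emb_LO calL K L.
Proof.
move=> calL1 Fk; have [R0 [R0to _]] := well_order_exists kappa.
have [k0 _] := infinite_setN0 kinf.
have [->|/set0P F0] := eqVneq F set0; first by exists (LOrder R0to).
have [e _ einj] := card_le_inj_on F0 Fk.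
(* An enumeration [s] of [F] by kappa; indices not coming from a member of [F]
   get an arbitrary order. *)
have /choice[s sP] k : exists L, forall K, F K -> e K = k -> L = K.
  have [[K FK eK]|nK] := pselect (exists2 K, F K & e K = k); last first.
    by exists (LOrder R0to) => K FK eK; case: nK; exists K.
  by exists K => K' FK' eK'; apply: einj; rewrite ?eK//; exact: mem_set.
pose S := @lexsum (Linorder R0to) kappa s (fun i => LO_total_order (s i)).
have [L [g [g' gK g'K] gE]] := @LO_iso kappa S card_prod_infinite.
exists L => K FK; have sK := sP (e K) K FK erefl.
apply: (@convex_range_emb calL K L (fun x : kappa => g (e K, x))) => //.
- by exists k0.
- move=> x y; rewrite -gE; apply/idP/idP => [xy|/lexsum_leP[[]//|[_]]].
    by apply/lexsum_leP; right; split=> //=; rewrite sK.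
  by rewrite /= sK.
move=> x y z xy yz [jx _ jxE] [jz _ jzE]; rewrite -(g'K y).
move: xy yz; rewrite -(g'K y) -jxE -jzE -!gE => /lexsum_leP xy /lexsum_leP yz.
case: (g' y) xy yz => i j.
case=> [/= ii1|[/= <- _]] => [[/= /lt_leN[]|[/= ii _]]|_]; last by exists j.
  by case: ii1.
by rewrite ii; exists j.
Qed.

Lemma unbounded_card_gt (F : set (LO kappa)) : calL point_order ->
  unbounded (convex_emb_LO calL) F -> card_lt [set: kappa] F.
Proof.
move=> calL1 Funb; have nFk : ~ (F #<= [set: kappa]).
  by move=> /(small_family_bounded calL1).
by split=> //; case: (card_le_total [set: kappa] F).
Qed.

End Unbounding.

(** A strictly increasing self-map of a subset of a well-order never decreases an
    element. *)
Lemma well_ordered_not_contracting (X : linorder) (g : X -> X) (A : set X) :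
  well_ordered X -> (forall x, A x -> A (g x)) ->
  (forall x y, A x -> A y -> lt x y -> lt (g x) (g y)) ->
  forall x, A x -> le x (g x).
Proof.
move=> woX gA gmono x Ax; apply: contrapT => nx.
have [|y [Ay ny] ymin] := woX [set y | A y /\ ~ le y (g y)]; first by exists x.
have gy : lt (g y) y by case: (le_or_lt y (g y)).
have /ymin : A (g y) /\ ~ le (g y) (g (g y)).
  by split; [exact: gA|apply: lt_leN; apply: gmono => //; exact: gA].
exact: ny.
Qed.


(** The closed initial segment below [d]. *)
Definition down_to (X : linorder) (d : X) : set X := [set e | le e d].

(** [h] restricts to an embedding of the segment [down_to d] with convex image;
    its values outside the segment do not matter. *)
Definition segment_emb (X L : linorder) (d : X) (h : X -> L) : Prop :=
  (forall x y, le x d -> le y d -> le x y = le (h x) (h y)) /\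
  convex (h @` down_to d).

Lemma segment_emb_suborder (X L : linorder) (d : X)
    (h : suborder (down_to d) -> L) :
  embedding h -> convex (range h) -> exists h', @segment_emb X L d h'.
Proof.
move=> hE hconv; pose in_seg x (xd : le x d) : suborder (down_to d) :=
  exist (fun x => x \in down_to d) x (mem_set xd).
pose h' x := if pselect (le x d) is left xd then h (in_seg x xd)
  else h (in_seg d (le_refl d)).
have h'E x (xd : le x d) : h' x = h (in_seg x xd).
  rewrite /h'; case: pselect => // ?; congr h; exact: val_inj.
exists h'; split=> [x y xd yd|]; first by rewrite !h'E -hE.
suff -> : h' @` down_to d = range h by [].
apply/seteqP; split=> _ [x xd <-]; first by rewrite h'E; exists (in_seg x xd).
have vd := set_mem (valP x); exists (val x) => //; rewrite h'E.
by congr h; exact: val_inj.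
Qed.

(** The end point of a segment is determined by the image interval
    [[h x0, h d]]. *)
Lemma segment_emb_inj (X L : linorder) (x0 d d' : X) (h h' : X -> L) :
  well_ordered X -> (forall x, le x0 x) -> segment_emb d h -> segment_emb d' h' ->
  h x0 = h' x0 -> h d = h' d' -> ~ lt d d'.
Proof.
move=> woX x0min [hE hconv] [h'E _] h0 hd dd'.
(* Both images are the interval between the common end points, so [h'] followed
   by the inverse of [h] maps [down_to d'] increasingly into [down_to d]. *)
have /choice[g gP] e : exists e1, le e d' -> le e1 d /\ h e1 = h' e.
  have [ed'|] := pselect (le e d'); last by exists e.
  have [||||e1 e1d he1] := hconv (h x0) (h' e) (h d).
  - by rewrite h0 -h'E ?x0min.
  - by rewrite hd -h'E// le_refl.
  - by exists x0 => //; exact: x0min.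
  - by exists d => //; exact: le_refl.
  - by exists e1.
have : le d' (g d').
  apply: (@well_ordered_not_contracting _ g (down_to d')) => //.
  - move=> x xd'; have [gd _] := gP x xd'; apply: le_trans gd _.
    by case: dd'.
  - move=> x y xd' yd' xy; have [gxd hx] := gP x xd'; have [gyd hy] := gP y yd'.
    case: (le_or_lt (g y) (g x)) => // gyx.
    by case: (lt_leN xy); rewrite h'E// -hx -hy -hE.
  - exact: le_refl.
have [gd _] := gP d' (le_refl d').
by move=> /le_trans/(_ gd); exact: lt_leN.
Qed.

(** The copies on kappa of the products of [M'] with the segments of kappa^+. *)
Lemma exists_unbounded kappa (calL : set linorder) : infinite_set [set: kappa] ->
  downward_closed kappa calL -> calL `<` Lin kappa -> calL !=set0 ->
  exists F : set (LO kappa),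
    is_card_succ [set: kappa] F /\ unbounded (convex_emb_LO calL) F.
Proof.
move=> kinf down [calLin nLin] calL0.
have calL1 := point_order_in calL0 calLin down.
have [k0 _] := infinite_setN0 kinf.
have [M MLin nM] : exists2 M, Lin kappa M & ~ calL M.
  apply: contrapT => nM; apply: nLin => M MLin; apply: contrapT => MnL.
  by apply: nM; exists M.
have [[m0 _] Mk] := MLin.
have [R0 [R0to _]] := well_order_exists kappa.
(* Replacing [M] by a product with kappa gives it size exactly kappa; it stays
   outside [calL], which is downward closed. *)
pose M' := lexprod M (Linorder R0to).
have nM' : ~ calL M'.
  move=> LM'; apply: nM; apply: (down M M') => //.
  exists (fun m => (m, k0)); apply: strict_mono_embedding => m m' mm'; split.
    by apply/lexsum_leP; left.
  by case: mm' => _ + [].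
have M'k : [set: M'] #<= [set: kappa].
  rewrite -setXTT; apply: card_le_trans (infinite_card_setX kinf).
  exact: card_le_setX.
have kM' : [set: kappa] #<= [set: M'].
  by apply: (@inj_on_card_le _ _ _ _ (fun k => (m0, k) : M')) => // x y _ _ [].
have M'Lin : Lin kappa M' by split=> //; exists (m0, k0).
have [X [D [woX Dsucc Dseg]]] := well_ordered_card_succ kinf.
have [x0 x0min] : exists x0 : X, forall y, le x0 y.
  have [d _] : D !=set0.
    apply/set0P/eqP => D0; case: Dsucc => -[_ +] _; apply.
    by rewrite D0; exact: card_ge0.
  by have [x _ xmin] := woX setT (ex_intro _ d I); exists x => y; exact: xmin.
pose S (d : X) := lexprod M' (suborder (down_to d)).
have Sk d : D d -> [set: S d] #= [set: kappa].
  move=> Dd; apply/card_eqPle; split.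
    rewrite -setXTT; apply: card_le_trans (infinite_card_setX kinf).
    apply: card_le_setX => //; apply: card_le_trans (Dseg d Dd).
    apply: (@inj_on_card_le _ _ _ _ val) => [x _|x y _ _ /val_inj//].
    exact: set_mem (valP x).
  apply: card_le_trans kM' _.
  pose top : suborder (down_to d) :=
    exist (fun x => x \in down_to d) d (mem_set (le_refl d)).
  by apply: (@inj_on_card_le _ _ _ _ (fun m => (m, top) : S d)) => // x y _ _ [].
have /choice[L LP] d : exists L : LO kappa,
    D d -> exists2 f : S d -> L, bijective f & embedding f.
  have [Dd|nDd] := pselect (D d); last by exists (LOrder R0to).
  by have [L Lf] := LO_iso (Sk d Dd); exists L.
have Funb : unbounded (convex_emb_LO calL) (L @` D).
  move=> [B FB].
  have /choice[h hP] d : exists h : X -> kappa, D d -> @segment_emb X B d h.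
    have [Dd|nDd] := pselect (D d); last by exists (fun=> k0).
    have [f fbij fE] := LP d Dd.
    have SB := convex_emb_iso fbij fE (FB _ (imageP L Dd)).
    pose bot : suborder (down_to d) :=
      exist (fun x => x \in down_to d) x0 (mem_set (x0min d)).
    have [|h hE hconv] := convex_emb_lexprod (j0 := bot) down M'Lin nM' _ SB.
      by move=> j; exact: x0min.
    by have [h' h'P] := segment_emb_suborder hE hconv; exists h'.
  case: Dsucc => -[_ nDk] _; apply: nDk.
  apply: card_le_trans (infinite_card_setX kinf).
  apply: (@inj_on_card_le _ _ _ _ (fun d => (h d x0, h d d))) => //.
  move=> d d' /set_mem Dd /set_mem Dd' [h0 hd].
  have hPd := hP d Dd; have hPd' := hP d' Dd'.
  case: (lt_or_eq d d') => // [dd'|d'd].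
    by case: (segment_emb_inj woX x0min hPd hPd' h0 hd dd').
  by case: (segment_emb_inj woX x0min hPd' hPd (esym h0) (esym hd) d'd).
exists (L @` D); split=> //; split; first exact: unbounded_card_gt Funb.
move=> V C kC; apply: card_le_trans (card_image_le L D) _.
by case: Dsucc => _; apply.
Qed.

Theorem theorem8p9 (kappa : Type) (calL : set linorder)
    (kappa_infinite : infinite_set [set: kappa])
    (calL_proper : calL `<` Lin kappa)
    (calL_nonempty : calL !=set0)
    (calL_down : downward_closed kappa calL)
    (calL_trans : Transitive (@convex_emb_LO kappa calL)) :
  (exists F : set (LO kappa),
     is_card_succ [set: kappa] F /\ unbounded (@convex_emb_LO kappa calL) F) /\
  (forall (U : Type) (B : set U),
     is_unbounding_number (@convex_emb_LO kappa calL) B <->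
     is_card_succ [set: kappa] B).
Proof.
have [F [Fsucc Funb]] :=
  exists_unbounded kappa_infinite calL_down calL_proper calL_nonempty.
have unb_gt F' : unbounded (@convex_emb_LO kappa calL) F' ->
    card_lt [set: kappa] F'.
  apply: unbounded_card_gt => //.
  by have [calLin _] := calL_proper; exact: (point_order_in calL_nonempty calLin).
split=> [|U B]; first by exists F.
split=> [[[F' [F'unb F'B]] Bmin]|[kB Bmin]].
  have /card_eqPle[F'leB BleF'] := F'B.
  split=> [|V C kC]; last first.
    by apply: card_le_trans (Bmin F Funb) _; case: Fsucc => _; apply.
  have [kF' nF'k] := unb_gt F' F'unb; split; first exact: card_le_trans F'leB.
  by move=> Bk; apply: nF'k; exact: card_le_trans Bk.
split=> [|F' F'unb]; last by apply: Bmin; exact: unb_gt.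
exists F; split=> //; case: Fsucc => kF Fmin; apply/card_eqPle; split.
  exact: Fmin.
exact: Bmin.
Qed.
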